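(* Let $N$ be even, let $\mathbb{G}=\mathbb{F}(\mathcal{W})$ and let $g=g_{1,N}\in\mathbb{G}[x_1,\ldots,x_N]$ be the Raz–Yehudayoff polynomial described in the context. Let $f_1,\ldots,f_m\in\mathbb{G}[x_1,\ldots,x_N]$ be polynomials such that each $f_i$ is computed by an (oblivious) read-once oblivious algebraic branching program (ROABP) of size $s_i$, and suppose $g=f_1+\cdots+f_m$. Let $s=\max\{s_1,\ldots,s_m\}$. Then $m=\frac{2^{\Omega(N^{1/5})}}{s^{c\log N}}$, where $c$ is a constant; i.e. there are absolute constants $c,c'>0$ such that $m\ge 2^{c'N^{1/5}}/s^{c\log N}$.
   Context: Let $\mathbb{F}$ be a field, $X=\{x_1,\ldots,x_N\}$ with $N$ even, and $\mathcal{W}=\{w_{i,k,j}\}_{i,k,j\in[N]}$ a set of further variables; $\mathbb{G}=\mathbb{F}(\mathcal{W})$ is the rational function field. For integers $i\le j$ let $[i,j]=\{k\in\mathbb{N}: i\le k\le j\}$. For every interval $[i,j]$ of even length define $g_{i,j}\in\mathbb{G}[X]$ by $g_{i,j}=1$ if $|[i,j]|=0$, and otherwise $g_{i,j}=(1+x_ix_j)g_{i+1,j-1}+\sum_k w_{i,k,j}\,g_{i,k}\,g_{k+1,j}$, where the sum is over $k\in[i+1,j-2]$ with $|[i,k]|$ even. Set $g=g_{1,N}$. An algebraic branching program (ABP) is a layered directed acyclic graph with a start node $s$ and a terminal node $t$, each edge labelled by a variable or a field constant; it computes the sum over all $s$-to-$t$ paths of the product of the edge labels; its size is its number of nodes.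 An ABP is oblivious if for every layer there is at most one variable labelling edges leaving that layer. An ROABP is an oblivious ABP in which each variable $x_i$ appears as an edge label in at most one layer. *)

(* Defs.v *)
From HB Require Import structures.
From mathcomp Require Import all_boot all_order all_algebra.
From mathcomp Require Import fraction zify.
From mathcomp.multinomials Require Import mpoly.

Set Implicit Arguments.
Unset Strict Implicit.
Unset Printing Implicit Defensive.

Import GRing.Theory.
Local Open Scope ring_scope.

(* One variable of W for every triple in [N]^3; the triple (i, k, j) is
   numbered by enum_rank. *)
Definition ratfunW (F : fieldType) (N : nat) : fieldType :=
  {fraction {mpoly F[#|{: 'I_N * 'I_N * 'I_N}|]}}.

Notation polyGX F N := {mpoly (ratfunW F N)[N]}.

(* Subscripts range over 1, ..., N as in the usual notation, so x_k is the
   library variable of index k - 1. Values at subscripts outside this range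
   are irrelevant: the polynomial g_(1,N) never uses them. *)
Definition xvar (F : fieldType) (N k : nat) : polyGX F N :=
  if insub k.-1 is Some a then 'X_(a : 'I_N) else 0.

Definition wvar (F : fieldType) (N i k j : nat) : polyGX F N :=
  match insub i.-1, insub k.-1, insub j.-1 with
  | Some a, Some b, Some c =>
      (tofrac 'X_(enum_rank (a : 'I_N, b : 'I_N, c : 'I_N))
        : ratfunW F N)%:MP
  | _, _, _ => 0
  end.

(* The cardinality of the integer interval [i, j]. *)
Definition ilen (i j : nat) : nat := (j.+1 - i)%N.

Section Recursion.
Variables (S : comNzRingType) (x : nat -> S) (w : nat -> nat -> nat -> S).

(* The first argument is recursion fuel; the length of the interval is enough
   of it, see RYint_rec. *)
Fixpoint RYfuel (n i j : nat) {struct n} : S :=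
  if n is n'.+1 then
    if ilen i j == 0%N then 1
    else (1 + x i * x j) * RYfuel n' i.+1 j.-1
         + \sum_(i.+1 <= k < j.-1 | ~~ odd (ilen i k))
             w i k j * RYfuel n' i k * RYfuel n' k.+1 j
  else 1.

Definition RYint (i j : nat) : S := RYfuel (ilen i j) i j.

Lemma RYfuelE (n n' i j : nat) :
  (ilen i j <= n)%N -> (ilen i j <= n')%N -> RYfuel n i j = RYfuel n' i j.
Proof.
elim: n n' i j => [|n IHn] [|n'] i j //=.
- by rewrite leqn0 => ->.
- by move=> _; rewrite leqn0 => ->.
have [//|] := eqVneq (ilen i j) 0%N; rewrite /ilen => len_n0 le_n le_n'.
congr (_ * _ + _); first by apply: IHn; rewrite /ilen; lia.
rewrite big_nat_cond [RHS]big_nat_cond; apply: eq_bigr => k.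
case/andP=> /andP[lt_ik lt_kj] _.
by congr (_ * _ * _); apply: IHn; rewrite /ilen; lia.
Qed.

Lemma RYint_nil (i j : nat) : ilen i j = 0%N -> RYint i j = 1.
Proof. by rewrite /RYint => ->. Qed.

Lemma RYint_rec (i j : nat) : ilen i j <> 0%N ->
  RYint i j =
    (1 + x i * x j) * RYint i.+1 j.-1
    + \sum_(i.+1 <= k < j.-1 | ~~ odd (ilen i k))
        w i k j * RYint i k * RYint k.+1 j.
Proof.
move=> /eqP/negPf len_n0; rewrite [LHS](@RYfuelE _ (ilen i j).+1) //=.
rewrite len_n0; move: len_n0; rewrite /ilen => len_n0.
congr (_ * _ + _); first by apply: RYfuelE; rewrite /ilen; lia.
rewrite big_nat_cond [RHS]big_nat_cond; apply: eq_bigr => k.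
case/andP=> /andP[lt_ik lt_kj] _.
by congr (_ * _ * _); apply: RYfuelE; rewrite /ilen; lia.
Qed.

End Recursion.

Definition RYpoly (F : fieldType) (N : nat) : polyGX F N :=
  RYint (@xvar F N) (@wvar F N) 1 N.

Inductive label (K : Type) (n : nat) := LVar of 'I_n | LConst of K.

(* Layers are numbered by natural numbers and every edge goes from a layer to
   the next one. abp_edge u v is None when there is no edge from u to v. *)
Record abp (K : fieldType) (n : nat) := ABP {
  abp_node : finType;
  abp_layer : abp_node -> nat;
  abp_start : abp_node;
  abp_term : abp_node;
  abp_edge : abp_node -> abp_node -> option (label K n);
  abp_layered : forall u v : abp_node,
    abp_edge u v -> abp_layer v = (abp_layer u).+1
}.

Section ABPTheory.
Variables (K : fieldType) (n : nat).

Definition label_poly (l : label K n) : {mpoly K[n]} :=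
  match l with LVar i => 'X_i | LConst a => a%:MP end.

Variable A : abp K n.

Definition abp_rel : rel (abp_node A) := [rel u v | isSome (abp_edge u v)].

Definition edge_poly (u v : abp_node A) : {mpoly K[n]} :=
  if abp_edge u v is Some l then label_poly l else 0.

Definition path_poly (u : abp_node A) (p : seq (abp_node A)) : {mpoly K[n]} :=
  \prod_(a <- pairmap edge_poly u p) a.

(* A path with d edges is the d-tuple of the nodes that follow the start node;
   by abp_path_size no path has #|abp_node A| edges or more. *)
Definition abp_poly : {mpoly K[n]} :=
  \sum_(d < #|abp_node A|)
    \sum_(p : d.-tuple (abp_node A) |
            path abp_rel (abp_start A) p
            && (last (abp_start A) p == abp_term A))
      path_poly (abp_start A) p.

Definition abp_size : nat := #|abp_node A|.

Lemma abp_path_size (u : abp_node A) (p : seq (abp_node A)) :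
  path abp_rel u p -> (size p < #|abp_node A|)%N.
Proof.
move=> Ap; have ltp : path (relpre (@abp_layer _ _ A) ltn) u p.
  by apply: sub_path Ap => v w /= /abp_layered ->.
have ltT : transitive (relpre (@abp_layer _ _ A) ltn).
  by move=> v w z; apply: ltn_trans.
have ltI : irreflexive (relpre (@abp_layer _ _ A) ltn).
  by move=> v; apply: ltnn.
have /card_uniqP/esym := @sorted_uniq _ _ ltT ltI (u :: p) ltp.
by rewrite /= => ->; apply: max_card.
Qed.

Definition is_oblivious : Prop :=
  forall (u v u' v' : abp_node A) (x y : 'I_n),
    abp_layer u = abp_layer u' ->
    abp_edge u v = Some (LVar K x) -> abp_edge u' v' = Some (LVar K y) ->
    x = y.

(* An edge label belongs to the layer that the edge leaves. *)
Definition is_read_once : Prop :=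
  forall (u v u' v' : abp_node A) (x : 'I_n),
    abp_edge u v = Some (LVar K x) -> abp_edge u' v' = Some (LVar K x) ->
    abp_layer u = abp_layer u'.

Definition is_roabp : Prop := is_oblivious /\ is_read_once.

End ABPTheory.

Definition roabp_computes (K : fieldType) (n : nat) (f : {mpoly K[n]})
    (s : nat) : Prop :=
  exists A : abp K n, [/\ is_roabp A, abp_size A = s & abp_poly A = f].

(* Main.v *)
Require Import Defs.
From mathcomp Require Import all_boot all_order all_algebra.
From mathcomp Require Import perm zify ring lra.
From mathcomp.multinomials Require Import mpoly.
From mathcomp Require Import reals exp.

(** Evaluate everything at 0/1 points and fix a balanced two-colouring of the
    variables; a polynomial then becomes a matrix indexed by the assignments of
    the two colour classes.

    For [g] this matrix has full rank [2^(N/2)]: substituting for the [w]'s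
    suitable powers of one variable makes the leading coefficient of [g] a
    product of factors [1 + x_a x_b] over a perfect matching between the two
    classes.

    An ROABP of size [s], cut into [t] blocks of consecutively read variables,
    is a sum of [s^O(t)] products of functions of one block each, so its rank is
    at most [s^O(t)] times the product over the blocks of
    [2^min(#|Y_b|, #|Z_b|)], where [Y_b] and [Z_b] are the two colour classes in
    the block. With [q ~ N^(1/5)], [t = 6q], blocks of length [14400 q^2] and
    [s <= 2^q], a colouring having fewer than [3q] blocks of imbalance below [8q]
    therefore gives rank at most [2^(N/2 - 6q^2 + 2q)]. By an exponential moment
    bound all but a [2^(-6q)] fraction of the colourings have this property,
    while a fraction [1/(N+1) >= 2^(-5q)] is balanced. So fewer than [2^q]
    ROABPs would leave a balanced colouring that is good for all of them,
    contradicting full rank. If [s > 2^q] or [N] is bounded, the claimed bound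
    is at most [1]. *)

Set Implicit Arguments.
Unset Strict Implicit.
Unset Printing Implicit Defensive.

Import Order.TTheory GRing.Theory Num.Theory.
Local Open Scope ring_scope.

(** * Rank *)

(** A decomposition into at most [r] rank-one terms. It requires no numbering of rows and columns
    and passes directly through sums, entrywise products and reindexing. *)
Definition rank_le (K : fieldType) (A B : Type) (M : A -> B -> K) (r : nat) :=
  exists2 l : seq ((A -> K) * (B -> K)), (size l <= r)%N &
    forall a b, M a b = \sum_(z <- l) z.1 a * z.2 b.

Section RankLe.
Variables (K : fieldType) (A B : Type).
Implicit Types (M : A -> B -> K) (r : nat).

Lemma rank_le_ext M M' r : (forall a b, M a b = M' a b) ->
  rank_le M r -> rank_le M' r.
Proof. by move=> e [l sl El]; exists l => // a b; rewrite -e. Qed.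

Lemma rank_le_trans M r r' : (r <= r')%N -> rank_le M r -> rank_le M r'.
Proof. by move=> le_rr' [l sl El]; exists l => //; apply: leq_trans le_rr'. Qed.

Lemma rank_le0 : rank_le (fun (_ : A) (_ : B) => 0 : K) 0.
Proof. by exists [::] => // a b; rewrite big_nil. Qed.

Lemma rank_le_cst (k : K) : rank_le (fun (_ : A) (_ : B) => k) 1.
Proof.
by exists [:: (fun=> k, fun=> 1)] => // a b; rewrite big_seq1 mulr1.
Qed.

Lemma rank_leD M1 M2 r1 r2 : rank_le M1 r1 -> rank_le M2 r2 ->
  rank_le (fun a b => M1 a b + M2 a b) (r1 + r2).
Proof.
move=> [l1 s1 E1] [l2 s2 E2]; exists (l1 ++ l2).
  by rewrite size_cat leq_add.
by move=> a b; rewrite big_cat /= E1 E2.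
Qed.

(** Multiplying the two decompositions out gives one rank-one term for each pair of terms. *)
Lemma rank_leM M1 M2 r1 r2 : rank_le M1 r1 -> rank_le M2 r2 ->
  rank_le (fun a b => M1 a b * M2 a b) (r1 * r2).
Proof.
move=> [l1 s1 E1] [l2 s2 E2].
exists [seq ((fun a => z.1 a * z'.1 a), (fun b => z.2 b * z'.2 b))
         | z <- l1, z' <- l2].
  by rewrite size_allpairs leq_mul.
move=> a b; rewrite big_allpairs_dep E1 E2 big_distrlr /=.
by apply: eq_bigr => i _; apply: eq_bigr => j _; ring.
Qed.

Lemma rank_le_sum (I : Type) (s : seq I) (M : I -> A -> B -> K) (r : I -> nat) :
  (forall i, rank_le (M i) (r i)) ->
  rank_le (fun a b => \sum_(i <- s) M i a b) (\sum_(i <- s) r i).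
Proof.
move=> rM; elim: s => [|i s IHs].
  by rewrite big_nil; apply: rank_le_ext rank_le0 => a b; rewrite big_nil.
rewrite big_cons; apply: rank_le_ext (rank_leD (rM i) IHs) => a b.
by rewrite big_cons.
Qed.

Lemma rank_le_comp (A' B' : Type) (u : A' -> A) (v : B' -> B) M r :
  rank_le M r -> rank_le (fun a b => M (u a) (v b)) r.
Proof.
move=> [l sl El]; exists [seq (z.1 \o u, z.2 \o v) | z <- l].
  by rewrite size_map.
by move=> a b; rewrite El big_map.
Qed.

End RankLe.

(** A decomposition with [size l] terms factors the matrix through a space of that dimension, while
    a nonsingular matrix has rank [#|I|]. *)
Lemma rank_le_det (K : fieldType) (I : finType) (M : I -> I -> K) (r : nat) :
  \det (\matrix_(i < #|I|, j < #|I|) M (enum_val i) (enum_val j)) != 0 ->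
  rank_le M r -> (#|I| <= r)%N.
Proof.
move=> detM [l sl El]; apply: leq_trans sl.
set X := \matrix_(i, j) _ in detM.
pose z0 : (I -> K) * (I -> K) := (fun=> 0, fun=> 0).
have -> : #|I| = \rank X.
  by apply/esym/eqP; rewrite -[_ == _]/(row_free X) row_free_unit unitmxE unitfE.
have -> : X = (\matrix_(i < #|I|, k < size l) (nth z0 l k).1 (enum_val i))
     *m (\matrix_(k < size l, j < #|I|) (nth z0 l k).2 (enum_val j)).
  apply/matrixP => i j; rewrite !mxE El (big_nth z0) big_mkord.
  by apply: eq_bigr => k _; rewrite !mxE.
exact: mulmx_max_rank.
Qed.

Section Mix.
Variables (K : fieldType) (T : finType).
Implicit Types (a b c S X : {set T}) (f : {set T} -> K).

(** A set stands for the 0/1 assignment that is 1 exactly on it. The row index [a] supplies the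
    values on the colour class [c], the column index [b] those on the complement. Letting both range
    over all sets only repeats rows and columns. *)
Definition mix c a b : {set T} := (a :&: c) :|: (b :\: c).

(** Expand over the restriction [t] of the row to [S :&: c], or of the column to [S :\: c],
    whichever has fewer possibilities: once [t] is fixed, [f] depends on the other index alone. *)
Lemma rank_le_local c S f : (forall X, f X = f (X :&: S)) ->
  rank_le (fun a b => f (mix c a b)) (2 ^ minn #|S :&: c| #|S :\: c|).
Proof.
move=> fS; rewrite /minn; case: ltnP => _; rewrite -card_powerset.
- exists [seq ((fun a => (a :&: (S :&: c) == t)%:R), (fun b => f (mix c t b)))
           | t <- enum (powerset (S :&: c))].
    by rewrite size_map -cardE.
  move=> a b; rewrite big_map big_enum /= (bigD1 (a :&: (S :&: c))) /=; last first.
    by rewrite powersetE subsetIr.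
  rewrite eqxx mul1r big1 ?addr0 => [|t /andP[_ /negPf nt]]; last first.
    by rewrite eq_sym nt mul0r.
  rewrite fS [RHS]fS; congr f; apply/setP => x; rewrite !inE.
  by case: (x \in a); case: (x \in b); case: (x \in c); case: (x \in S).
- exists [seq ((fun a => f (mix c a t)), (fun b => (b :&: (S :\: c) == t)%:R))
           | t <- enum (powerset (S :\: c))].
    by rewrite size_map -cardE.
  move=> a b; rewrite big_map big_enum /= (bigD1 (b :&: (S :\: c))) /=; last first.
    by rewrite powersetE subsetIr.
  rewrite eqxx mulr1 big1 ?addr0 => [|t /andP[_ /negPf nt]]; last first.
    by rewrite eq_sym nt mulr0.
  rewrite fS [RHS]fS; congr f; apply/setP => x; rewrite !inE.
  by case: (x \in a); case: (x \in b); case: (x \in c); case: (x \in S).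
Qed.

End Mix.

(** * Counting colourings *)

Section Counting.
Local Open Scope nat_scope.

(** The quotient [(n - j) / (j + 1)] of consecutive entries is at least 1 below the middle; symmetry
    gives the upper half. *)
Lemma bin_le_central n k : 'C(n, k) <= 'C(n, n./2).
Proof.
have step i j : i <= j -> j <= n./2 -> 'C(n, i) <= 'C(n, j).
  elim: j => [|j IHj]; first by rewrite leqn0 => /eqP ->.
  rewrite leq_eqVlt => /predU1P[-> //|]; rewrite ltnS => le_ij lt_jn.
  apply: leq_trans (IHj le_ij (ltnW lt_jn)) _.
  rewrite -(@leq_pmul2l j.+1) // mul_bin_left leq_mul2r; apply/orP; right.
  by lia.
have [le_k|gt_k] := leqP k n./2; first exact: step.
have [le_kn|gt_kn] := leqP k n; last by rewrite bin_small.
by rewrite -bin_sub //; apply: step => //; lia.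
Qed.

(** The [n.+1] entries of the binomial row sum to [2 ^ n], and none exceeds the central one. *)
Lemma central_bin_ge n : 2 ^ n <= n.+1 * 'C(n, n./2).
Proof.
have := expnDn 1 1 n; rewrite addn1 => ->.
rewrite -[X in X * _](card_ord n.+1) -sum_nat_const leq_sum // => i _.
by rewrite !exp1n !muln1 bin_le_central.
Qed.

(* Consecutive squares ['C(2m, m)^2] have quotient
   [4 (2m+1)^2 / (m+1)^2 <= 16 (2m+1) / (2m+3)]. *)
Lemma central_bin_le m : 'C(m.*2, m) ^ 2 * m.*2.+1 <= 16 ^ m.
Proof.
elim: m => [//|m IHm].
have e : m.+1 * 'C(m.+1.*2, m.+1) = 2 * m.*2.+1 * 'C(m.*2, m).
  have e1 : m.+1 * 'C(m.+1.*2, m.+1) = m.+1.*2 * 'C(m.*2.+1, m).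
    by rewrite doubleS -mul_bin_diag.
  have e2 : m.+1 * 'C(m.*2.+1, m) = m.*2.+1 * 'C(m.*2, m).
    have := mul_bin_down m.*2.+1 m.
    by rewrite [_ .-1]/= => ->; congr (_ * _); lia.
  by rewrite e1 -[m.+1.*2]mul2n -mulnA e2 mulnA.
rewrite -(@leq_pmul2l (m.+1 ^ 2)) ?expn_gt0 // mulnA -expnMn e.
rewrite !expnMn [16 ^ _]expnS; move: ('C(_, _) ^ 2) (16 ^ m) IHm => C P IHm.
have le : m.*2.+1 * m.+1.*2.+1 <= 4 * m.+1 ^ 2 by rewrite expnS expn1; nia.
have := leq_mul le IHm.
move: (m.*2.+1) (m.+1.*2.+1) (m.+1 ^ 2) C P {IHm e le} => d d3 M2 C P le.
have -> : 2 ^ 2 * d ^ 2 * C * d3 = 4 * (d * d3 * (C * d)) by ring.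
have -> : M2 * (16 * P) = 4 * (4 * M2 * P) by ring.
by rewrite leq_mul2l.
Qed.

Variable T : finType.
Implicit Types (S U c : {set T}).

(** Subsets of a disjoint union correspond to pairs of subsets of its two parts. *)
Lemma sum_subset_disjointU U S (f g : {set T} -> nat) : [disjoint U & S] ->
  \sum_(c : {set T} | c \subset U :|: S) f (c :&: U) * g (c :&: S)
  = (\sum_(c : {set T} | c \subset U) f c) * (\sum_(c : {set T} | c \subset S) g c).
Proof.
move=> dUS; rewrite big_distrlr /= pair_big /=.
rewrite (reindex_onto (fun p : {set T} * {set T} => p.1 :|: p.2)
   (fun c => (c :&: U, c :&: S))) /=; last first.
  by move=> c cUS; rewrite -setIUr; apply/setIidPl.
have UI (a b : {set T}) : a \subset U -> b \subset S -> (a :|: b) :&: U = a.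
  move=> aU bS; rewrite setIUl (setIidPl aU).
  suff -> : b :&: U = set0 by rewrite setU0.
  by apply/eqP; rewrite setI_eq0 disjoint_sym; apply: disjointWr bS dUS.
have SI (a b : {set T}) : a \subset U -> b \subset S -> (a :|: b) :&: S = b.
  move=> aU bS; rewrite setIUl (setIidPl bS).
  suff -> : a :&: S = set0 by rewrite set0U.
  by apply/eqP; rewrite setI_eq0; apply: disjointWl aU dUS.
apply: eq_big => [[a b]|[a b]] /=.
  apply/idP/idP => [/andP[_ /eqP[<- <-]]|/andP[aU bS]].
    by rewrite !subsetIr.
  by rewrite setUSS //= UI // SI.
by case/andP=> _ /eqP[-> ->].
Qed.

Definition fiber (blk : T -> nat) (b : nat) : {set T} := [set x | blk x == b].

(** Independence of the blocks: a uniformly random colouring restricts to independent uniform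
    colourings of the fibers. *)
Lemma sum_prod_fiber (blk : T -> nat) (k : nat) (h : nat -> {set T} -> nat) :
  (forall x, blk x < k) ->
  \sum_(c : {set T}) \prod_(b < k) h b (c :&: fiber blk b)
  = \prod_(b < k) \sum_(c : {set T} | c \subset fiber blk b) h b c.
Proof.
move=> blk_lt; pose U k' : {set T} := [set x | blk x < k'].
suff: \sum_(c : {set T} | c \subset U k) \prod_(b < k) h b (c :&: fiber blk b)
  = \prod_(b < k) \sum_(c : {set T} | c \subset fiber blk b) h b c.
  move=> <-; apply: eq_bigl => c; apply/esym/subsetP => x _.
  by rewrite inE blk_lt.
elim: {blk_lt} k => [|k IHk].
  rewrite big_ord0; have -> : U 0 = set0 by apply/setP => x; rewrite !inE.
  rewrite (eq_bigl (pred1 set0)) => [|c]; last by rewrite subset0.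
  by rewrite big_pred1_eq big_ord0.
rewrite big_ord_recr /= -IHk -sum_subset_disjointU; last first.
  rewrite -setI_eq0; apply/eqP/setP => x; rewrite !inE.
  by case: eqP => [->|]; rewrite ?ltnn ?andbF.
have -> : U k :|: fiber blk k = U k.+1.
  by apply/setP => x; rewrite !inE ltnS [in RHS]leq_eqVlt orbC.
apply: eq_bigr => c _; rewrite big_ord_recr /=; congr (_ * _).
apply: eq_bigr => b _; congr h; apply/setP => x; rewrite !inE.
by case: eqP => [->|]; rewrite ?andbF ?ltn_ord ?andbT.
Qed.

(** The absolute difference of the two class sizes in [S]: at least one of the truncated
    subtractions is 0. *)
Definition imbalance c S : nat :=
  (#|S :&: c| - #|S :\: c|) + (#|S :\: c| - #|S :&: c|).

Definition near_balanced (D : nat) S c : bool := imbalance c S < D.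

Lemma card_subset_pred S (P : pred nat) :
  #|[set c : {set T} | (c \subset S) && P #|c| ]|
  = \sum_(k < #|S|.+1 | P k) 'C(#|S|, k).
Proof.
rewrite -sum1_card.
rewrite (partition_big (fun c : {set T} => inord #|c| : 'I_#|S|.+1)
  (fun k => P k)) /=.
  apply: eq_bigr => k Pk; rewrite -cards_draws -[RHS]sum1_card.
  apply: eq_bigl => c; rewrite !inE.
  have [cS|] //= := boolP (c \subset S).
  have lt_c : #|c| < #|S|.+1 by rewrite ltnS subset_leq_card.
  rewrite -val_eqE /= inordK //.
  by case: eqP => [->|]; rewrite ?andbF ?Pk.
by move=> c; rewrite inE => /andP[/subset_leq_card cS]; rewrite inordK.
Qed.

(** At most [D] sizes are nearly balanced, and each is attained by at most a central binomial
    coefficient of subsets. Comparing squares brings this into the form of [central_bin_le]. *)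
Lemma card_near_balanced D S m : #|S| = m.*2 -> D ^ 2 * 15 ^ 2 <= m.*2.+1 ->
  15 * #|[set c : {set T} | (c \subset S) && near_balanced D S c]| <= 2 ^ #|S|.
Proof.
move=> cS hD.
have -> : [set c : {set T} | (c \subset S) && near_balanced D S c] =
    [set c : {set T} | (c \subset S) &&
       ((#|c| - (#|S| - #|c|)) + ((#|S| - #|c|) - #|c|) < D)].
  apply/setP => c; rewrite !inE; have [cSs|] //= := boolP (c \subset S).
  by rewrite /near_balanced /imbalance cardsD (setIidPr cSs).
rewrite (@card_subset_pred S (fun k => (k - (#|S| - k)) + ((#|S| - k) - k) < D)) cS.
have card_le : #|[pred k : 'I_m.*2.+1 | k - (m.*2 - k) + (m.*2 - k - k) < D]| <= D.
  case: D {hD} => [|D].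
    by rewrite (eq_card0 (A := _)) // => k; rewrite !inE ltn0.
  rewrite -[X in _ <= X]card_ord.
  (* The admissible sizes form a window around [m]; subtracting its lower end numbers them from
     0. *)
  pose g (k : 'I_m.*2.+1) : 'I_D.+1 := inord ((k + D./2) - m).
  rewrite -(card_in_imset (f := g)); first exact: max_card.
  move=> k k'; rewrite !inE => hk hk' /(congr1 (@nat_of_ord _)).
  have lk := ltn_ord k; have lk' := ltn_ord k'.
  by rewrite /g !inordK => [e| |]; first (apply: val_inj => /=); lia.
apply: leq_trans (_ : 15 * (D * 'C(m.*2, m)) <= _).
  rewrite leq_mul2l /=; apply: leq_trans (_ : _ <= \sum_(k < m.*2.+1 |
    k - (m.*2 - k) + (m.*2 - k - k) < D) 'C(m.*2, m)) _.
    by apply: leq_sum => k _; have := bin_le_central m.*2 k; rewrite doubleK.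
  by rewrite sum_nat_const leq_mul2r card_le orbT.
rewrite -leq_sqr.
have -> : (2 ^ m.*2) ^ 2 = 16 ^ m.
  by rewrite -mul2n -expnM -mulnA [m * 2]mulnC mulnA expnM.
apply: leq_trans (central_bin_le m).
have -> : (15 * (D * 'C(m.*2, m))) ^ 2 = 'C(m.*2, m) ^ 2 * (D ^ 2 * 15 ^ 2).
  by rewrite !expnMn; ring.
by rewrite leq_mul2l hD orbT.
Qed.

(** The weight is [1 + 15 e] for the bit [e] of near balance, and [e] is 1 with probability at most
    1/15. So the expected weight is at most 2. *)
Lemma sum_near_balanced D S m : #|S| = m.*2 -> D ^ 2 * 15 ^ 2 <= m.*2.+1 ->
  \sum_(c : {set T} | c \subset S) 16 ^ near_balanced D S c <= 2 ^ #|S|.+1.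
Proof.
move=> cS hD; have le := card_near_balanced cS hD.
rewrite (eq_bigr (fun c => 1 + 15 * near_balanced D S c)); last first.
  by move=> c _; case: near_balanced.
rewrite big_split /= -big_distrr /= expnS mul2n -addnn leq_add //.
  rewrite sum1_card -card_powerset; apply: subset_leq_card.
  by apply/subsetP => c; rewrite powersetE.
apply: leq_trans le; rewrite leq_mul2l /= -sum1_card.
rewrite big_mkcond [X in _ <= X]big_mkcond.
by apply: leq_sum => c _; rewrite inE; case: (c \subset S); case: near_balanced.
Qed.

Lemma imbalanceI c S : imbalance (c :&: S) S = imbalance c S.
Proof.
by rewrite /imbalance setIA setIAC setIid setDE setCI setIUr setICr setU0 -setDE.
Qed.

(* Exponential Markov inequality: weight 16 for every nearly balanced block. *)
Lemma card_many_near_balanced (blk : T -> nat) (t D m k : nat) :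
  (forall x, blk x <= t) ->
  (forall b, b < t -> #|fiber blk b| = m.*2) ->
  D ^ 2 * 15 ^ 2 <= m.*2.+1 ->
  16 ^ k * #|[set c : {set T} |
                k <= \sum_(b < t) near_balanced D (fiber blk b) c]|
  <= 2 ^ (#|T| + t).
Proof.
move=> blk_le card_blk hD.
(* The remainder block [t] can have any size, so it gets weight 1. *)
pose h b c := if b < t then 16 ^ near_balanced D (fiber blk b) c else 1.
have eT : #|T| = \sum_(b < t.+1) #|fiber blk b|.
  rewrite -sum1_card (partition_big (fun x => inord (blk x) : 'I_t.+1) predT) //=.
  apply: eq_bigr => b _; rewrite -sum1_card; apply: eq_bigl => x.
  by rewrite inE -val_eqE /= inordK // ltnS.
apply: leq_trans
  (_ : \sum_(c : {set T}) \prod_(b < t.+1) h b (c :&: fiber blk b) <= _).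
  rewrite -sum1_card big_distrr /= big_mkcond /=; apply: leq_sum => c _.
  rewrite inE muln1; case: ifP => // le_k.
  rewrite big_ord_recr /= {2}/h ltnn muln1.
  rewrite (eq_bigr (fun b : 'I_t => 16 ^ near_balanced D (fiber blk b) c)); last first.
    by move=> b _; rewrite /h ltn_ord /near_balanced imbalanceI.
  by rewrite -expn_sum leq_exp2l.
rewrite sum_prod_fiber => [|x]; last by rewrite ltnS.
rewrite eT !big_ord_recr /= -addnA [_ + t]addnC addnA expnD leq_mul //.
  have et : 2 ^ t = \prod_(b < t) 2 by rewrite prod_nat_const card_ord.
  rewrite expnD expn_sum et -big_split /=.
  apply: leq_prod => b _; rewrite /h ltn_ord mulnC -expnS.
  exact: sum_near_balanced (card_blk b (ltn_ord b)) hD.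
rewrite /h ltnn sum1_card -card_powerset.
by apply: subset_leq_card; apply/subsetP => c; rewrite powersetE.
Qed.

Lemma card_balanced : ~~ odd #|T| ->
  2 ^ #|T| <= #|T|.+1 * #|[set c : {set T} | #|c| == #|T|./2]|.
Proof.
move=> evT; apply: leq_trans (central_bin_ge _) _.
by rewrite card_draws.
Qed.

(** In each block, twice the minimum plus the absolute difference is the block size. Thus imbalance
    lowers the exponent in the rank bound. *)
Lemma sum_min_imbalance (blk : T -> nat) (k : nat) c : (forall x, blk x < k) ->
  (\sum_(b < k) minn #|fiber blk b :&: c| #|fiber blk b :\: c|).*2
  + \sum_(b < k) imbalance c (fiber blk b) = #|T|.
Proof.
case: k => [|k] blk_lt.
  rewrite !big_ord0; apply/esym/eq_card0 => x.
  by have := blk_lt x; rewrite ltn0.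
rewrite -mul2n big_distrr /= -big_split /=.
rewrite -sum1_card (partition_big (fun x => inord (blk x) : 'I_k.+1) predT) //=.
apply: eq_bigr => b _.
rewrite (eq_bigl (mem (fiber blk b))) => [|x]; last first.
  by rewrite !inE -val_eqE /= inordK.
by rewrite sum1_card -(cardsID c (fiber blk b)) /imbalance; lia.
Qed.

End Counting.

(** * Read-once oblivious branching programs *)

Section Walks.
Variables (K : fieldType) (N : nat) (A : abp K N).
Implicit Types (X Y c S : {set 'I_N}) (u v : abp_node A).

Definition point (X : {set 'I_N}) : 'I_N -> K := fun i => (i \in X)%:R.

Definition edge_val X u v : K := (edge_poly u v).@[point X].

(** The entry at [(u, v)] of the [d]-th power of the matrix of edge values. *)
Fixpoint walk_val X (d : nat) u v : K :=
  if d is d'.+1 then \sum_z edge_val X u z * walk_val X d' z v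
  else (u == v)%:R.

Lemma walk_valD X d1 d2 u v :
  walk_val X (d1 + d2) u v = \sum_z walk_val X d1 u z * walk_val X d2 z v.
Proof.
elim: d1 u => [|d1 IHd] u /=.
  rewrite add0n (bigD1 u) //= eqxx mul1r big1 ?addr0 // => z /negPf nz.
  by rewrite eq_sym nz mul0r.
rewrite (eq_bigr (fun z =>
  \sum_y edge_val X u z * walk_val X d1 z y * walk_val X d2 y v)).
  by rewrite exchange_big /=; apply: eq_bigr => y _; rewrite big_distrl.
by move=> z _; rewrite IHd big_distrr /=; apply: eq_bigr => y _; rewrite mulrA.
Qed.

Lemma edge_val_layer X u v :
  edge_val X u v != 0 -> abp_layer v = (abp_layer u).+1.
Proof.
rewrite /edge_val /edge_poly.
case E: (abp_edge u v) => [l|]; last by rewrite meval0 eqxx.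
by move=> _; apply: abp_layered; rewrite E.
Qed.

Lemma walk_val_layer X d u v :
  walk_val X d u v != 0 -> abp_layer v = (abp_layer u + d)%N.
Proof.
elim: d u => [|d IHd] u /=.
  by have [->|] := eqVneq u v; rewrite ?addn0 ?eqxx.
move=> nz; have [z] : exists z, edge_val X u z * walk_val X d z v != 0.
  apply/existsP; apply: contraNT nz; rewrite negb_exists => /forallP z0.
  by rewrite big1 // => z _; have /negPn/eqP := z0 z.
by rewrite mulf_eq0 negb_or => /andP[/edge_val_layer e /IHd ->]; rewrite e addSnnS.
Qed.

(** The sum admits every node sequence, not only paths: a step without an edge has value 0. *)
Lemma sum_path_val X d u v :
  \sum_(p : d.-tuple (abp_node A) | last u p == v)
     \prod_(e <- pairmap (edge_val X) u p) e = walk_val X d u v.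
Proof.
elim: d u => [|d IHd] u /=.
  rewrite big_mkcond (big_pred1 [tuple]) => [|p]; last first.
    by apply/esym/eqP/val_inj; case: p => -[].
  by rewrite /= big_nil; case: eqP.
pose g (z : abp_node A * d.-tuple (abp_node A)) : d.+1.-tuple (abp_node A) :=
  [tuple of z.1 :: z.2].
rewrite (reindex g) /=; last first.
  exists (fun p => (thead p, [tuple of behead p])) => [[z p] _|p _].
    by congr pair => //; apply: val_inj.
  by rewrite /g /= [RHS]tuple_eta.
rewrite (eq_bigr (fun z : abp_node A * d.-tuple (abp_node A) => edge_val X u z.1 *
    \prod_(e <- pairmap (edge_val X) z.1 z.2) e)) => [|z _]; last by rewrite big_cons.
rewrite -(pair_big_dep predT (fun z (p : d.-tuple _) => last z p == v)
  (fun z (p : d.-tuple _) =>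
     edge_val X u z * \prod_(e <- pairmap (edge_val X) z p) e)) /=.
by apply: eq_bigr => z _; rewrite -big_distrr /= IHd.
Qed.

Lemma meval_path_poly X u (p : seq (abp_node A)) :
  (path_poly u p).@[point X] = \prod_(e <- pairmap (edge_val X) u p) e.
Proof.
rewrite /path_poly; elim: p u => [|z p IHp] u /=; first by rewrite !big_nil meval1.
by rewrite !big_cons mevalM IHp.
Qed.

Lemma path_val0 X u (p : seq (abp_node A)) : ~~ path (@abp_rel _ _ A) u p ->
  \prod_(e <- pairmap (edge_val X) u p) e = 0.
Proof.
elim: p u => [|z p IHp] u //=; rewrite big_cons negb_and => /orP[|/IHp->].
  rewrite /abp_rel /= /edge_val /edge_poly; case: (abp_edge u z) => //= _.
  by rewrite meval0 mul0r.
by rewrite mulr0.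
Qed.

Lemma meval_abp_poly X : (abp_poly A).@[point X] =
  \sum_(d < #|abp_node A|) walk_val X d (abp_start A) (abp_term A).
Proof.
rewrite /abp_poly raddf_sum; apply: eq_bigr => d _ /=.
rewrite raddf_sum -sum_path_val /= [LHS]big_mkcond [RHS]big_mkcond /=.
apply: eq_bigr => p _; rewrite meval_path_poly.
by case: (boolP (path _ _ _)) => [|/path_val0->] //=; case: ifP.
Qed.

Definition labelled u (x : 'I_N) : bool :=
  [exists v, if abp_edge u v is Some (LVar y) then y == x else false].

(* Unread variables get pairwise distinct layers beyond those of the program. *)
Definition read_layer (x : 'I_N) : nat :=
  if [pick u | labelled u x] is Some u then abp_layer u
  else ((\max_(u : abp_node A) abp_layer u).+1 + x)%N.

Lemma labelledP u x :
  reflect (exists v, abp_edge u v = Some (LVar K x)) (labelled u x).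
Proof.
apply: (iffP existsP) => -[v]; last by move=> e; exists v; rewrite e.
by case E: (abp_edge u v) => [[y|]|] // /eqP <-; exists v.
Qed.

Hypothesis roA : is_roabp A.

(** By the read-once property, the layer does not depend on which node [pick] returns. *)
Lemma read_layerE u v x : abp_edge u v = Some (LVar K x) ->
  read_layer x = abp_layer u.
Proof.
move=> Ex; rewrite /read_layer; case: pickP => [u' /labelledP[v' Ex']|/(_ u)].
  exact: (roA.2 _ _ _ _ _ Ex' Ex).
by case/labelledP; exists v.
Qed.

(** Obliviousness separates the variables that are read; the offsets separate the others. So the
    layers order all variables linearly. *)
Lemma read_layer_inj : injective read_layer.
Proof.
move=> x y; rewrite /read_layer.
have le_max u : (abp_layer u <= \max_(u : abp_node A) abp_layer u)%N by apply: leq_bigmax.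
case: pickP => [u /labelledP[v Ex]|_]; case: pickP => [u' /labelledP[v' Ey]|_].
- by move=> e; apply: roA.1 e Ex Ey.
- by have := le_max u; lia.
- by have := le_max u'; lia.
- by move=> e; apply: val_inj => /=; lia.
Qed.

Lemma edge_val_local X Y u v :
  (forall x, read_layer x = abp_layer u -> (x \in X) = (x \in Y)) ->
  edge_val X u v = edge_val Y u v.
Proof.
rewrite /edge_val /edge_poly => XY; case E: (abp_edge u v) => [[x|a]|] /=.
- by rewrite !mevalXU /point XY // (read_layerE E).
- by rewrite !mevalC.
- by rewrite !meval0.
Qed.

Lemma walk_val_local X Y d u v :
  (forall x, (abp_layer u <= read_layer x < abp_layer u + d)%N ->
     (x \in X) = (x \in Y)) ->
  walk_val X d u v = walk_val Y d u v.
Proof.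
elim: d u => [|d IHd] u XY //=; apply: eq_bigr => z _.
have -> : edge_val X u z = edge_val Y u z.
  by apply: edge_val_local => x ex; apply: XY; lia.
have [->|nz] := eqVneq (edge_val Y u z) 0; first by rewrite !mul0r.
congr (_ * _); apply: IHd => x; rewrite (edge_val_layer nz) => hx.
by apply: XY; lia.
Qed.

(** The thresholds [th] cut the layers into [k] segments, and segment [b] reads only variables of
    [S b]. Each cut costs a sum over the middle node, hence a factor [#|abp_node A|]; each segment
    has rank bounded by [rank_le_local]. *)
Lemma rank_le_walk (S : nat -> {set 'I_N}) (th : nat -> nat) c k d u v :
  th 0%N = 0%N ->
  (forall x b, (b < k)%N -> (th b <= read_layer x < th b.+1)%N -> x \in S b) ->
  (d <= th k - abp_layer u)%N ->
  rank_le (fun a b => walk_val (mix c a b) d u v)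
    (#|abp_node A| ^ k * \prod_(b < k) 2 ^ minn #|S b :&: c| #|S b :\: c|).
Proof.
move=> th0; elim: k d v => [|k IHk] d v inS le_d.
  rewrite big_ord0 /=; move: le_d; rewrite th0 sub0n leqn0 => /eqP ->.
  exact: rank_le_cst.
(* The first [d1] steps stay below layer [th k]. If [u] already lies beyond it, truncated
   subtraction makes [d1] zero and the whole walk belongs to the last segment. *)
pose d1 := minn d (th k - abp_layer u); pose d2 := (d - d1)%N.
have -> : d = (d1 + d2)%N by rewrite /d2 subnKC // /d1 geq_minl.
rewrite big_ord_recr /= expnS; set r1 := (_ ^ k)%N; set r2 := (\prod_(b < k) _)%N.
set r3 := (2 ^ _)%N.
apply: rank_le_ext (fun a b => esym (walk_valD (mix c a b) d1 d2 u v)) _.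
apply: (@rank_le_trans _ _ _ _ (\sum_(z <- index_enum (abp_node A)) (r1 * r2 * r3))).
  by rewrite sum_nat_const; apply/eq_leq; rewrite -!mulnA.
apply: rank_le_sum => z.
have [ez|nz] := eqVneq (abp_layer z) (abp_layer u + d1)%N; last first.
  apply: rank_le_trans (leq0n _) _.
  apply: rank_le_ext (rank_le0 _ _ _) => a b.
  have [->|/walk_val_layer e] := eqVneq (walk_val (mix c a b) d1 u z) 0.
    by rewrite mul0r.
  by rewrite e eqxx in nz.
apply: rank_leM.
  apply: IHk => [x b lt_b|]; first by apply: inS; apply: ltnW.
  exact: geq_minr.
apply: rank_le_local (fun X => walk_val X d2 z v) _ => X.
apply: walk_val_local => x; rewrite ez => hx; rewrite inE inS ?andbT //.
by move: le_d hx; rewrite /d2 /d1; lia.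
Qed.

End Walks.

Lemma card_ord_divn N B b : (b.+1 * B <= N)%N -> (0 < B)%N ->
  #|[set k : 'I_N | (k %/ B == b)%N]| = B.
Proof.
move=> le_bB B_gt0.
have lt_j (j : 'I_B) : (b * B + j < N)%N by have := ltn_ord j; lia.
pose g j : 'I_N := Ordinal (lt_j j).
rewrite -[RHS]card_ord -[RHS]cardsT -(@card_imset _ _ g); last first.
  by move=> i j /(congr1 val) /= /addnI/val_inj.
apply: eq_card => k; rewrite inE; apply/eqP/imsetP => [e|[j _ ->] /=].
  exists (Ordinal (ltn_pmod k B_gt0)) => //; apply: val_inj => /=.
  by rewrite -e -divn_eq.
by rewrite divnMDl // divn_small ?addn0.
Qed.

(* The blocks are runs of [B] variables that are consecutive in reading order;
   block [t] collects the rest. *)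
Lemma roabp_blocks (K : fieldType) (N : nat) (f : {mpoly K[N]}) (s t B : nat) :
  roabp_computes f s -> (t * B <= N)%N -> (0 < B)%N ->
  exists blk : 'I_N -> nat,
  [/\ forall x, (blk x <= t)%N,
      forall b, (b < t)%N -> #|fiber blk b| = B &
      forall c : {set 'I_N},
        rank_le (fun a b => f.@[point K (mix c a b)])
          (s ^ t.+2 * \prod_(b < t.+1)
             2 ^ minn #|fiber blk b :&: c| #|fiber blk b :\: c|)].
Proof.
case=> A [roA <- <-] le_tB B_gt0.
pose rk (x : 'I_N) := #|[set y | (read_layer A y < read_layer A x)%N]|.
have rk_mono x y : (read_layer A x < read_layer A y)%N -> (rk x < rk y)%N.
  move=> lt_xy; apply: proper_card; apply/properP; split.
    by apply/subsetP => z; rewrite !inE => /ltn_trans; apply.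
  by exists x; rewrite !inE ?ltnn.
have rk_le x y : (read_layer A x <= read_layer A y)%N -> (rk x <= rk y)%N.
  by rewrite leq_eqVlt => /predU1P[/(read_layer_inj roA)->|/rk_mono/ltnW].
have rk_lt x : (rk x < N)%N.
  rewrite -[X in (_ < X)%N]card_ord -cardsT; apply: proper_card; apply/properP; split.
    by apply/subsetP.
  by exists x; rewrite !inE ?ltnn.
have rk_inj : injective (fun x => Ordinal (rk_lt x)).
  move=> x y /(congr1 val) /= e; apply: (read_layer_inj roA).
  by case: (ltngtP (read_layer A x) (read_layer A y)) => // /rk_mono; rewrite e ltnn.
pose blk x := minn t (rk x %/ B).
have blk_le x y : (read_layer A x <= read_layer A y)%N -> (blk x <= blk y)%N.
  by move/rk_le/(leq_div2r B); rewrite /blk; lia.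
exists blk; split=> [x|b lt_bt|c]; first exact: geq_minl.
  rewrite -(card_imset _ rk_inj) -[RHS](@card_ord_divn N B b) //; last first.
    by apply: leq_trans le_tB; rewrite leq_mul2r lt_bt orbT.
  apply: eq_card => k; rewrite inE; apply/imsetP/eqP => [[x]|e].
    by rewrite inE /blk => /eqP e -> /=; lia.
  have [g gK Kg] := injF_bij rk_inj.
  exists (g k); last by rewrite Kg.
  have := congr1 val (Kg k) => /= ek.
  by rewrite inE /blk ek; apply/eqP; lia.
(* [M] is large enough that the last segment, from [th t] to [M], contains the end of every walk
   considered; the other thresholds are the ends of the blocks in reading order. *)
pose M := (\max_x (read_layer A x).+1 +
  (\max_(u : abp_node A) abp_layer u + #|abp_node A|))%N.
pose th b := if (b <= t)%N then \max_(x | (blk x < b)%N) (read_layer A x).+1 else M.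
have thP x b : (b <= t)%N -> (read_layer A x < th b)%N = (blk x < b)%N.
  rewrite /th => ->; apply/idP/idP => [|lt_b].
    apply: contraTT; rewrite -!leqNgt => le_b; apply/bigmax_leqP => y lt_y.
    by rewrite ltnNge; apply: contraL lt_y => /blk_le; lia.
  exact: (@leq_bigmax_cond _ (fun x => blk x < b)%N (fun x => (read_layer A x).+1) x).
apply: rank_le_ext (fun a b => esym (meval_abp_poly A (mix c a b))) _.
rewrite /abp_size expnS -mulnA; set r := (_ * \prod_(b < _) _)%N.
(* Summing over the possible path lengths costs one more factor [s], beyond the [t.+1] from the
   segments. *)
apply: (@rank_le_trans _ _ _ _ (\sum_(d <- index_enum 'I_#|abp_node A|) r)).
  by rewrite sum_nat_const card_ord.
apply: rank_le_sum => d; apply: (@rank_le_walk _ _ _ roA (fiber blk) th) => //.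
- by rewrite /th leq0n big_pred0.
- move=> x b; rewrite ltnS => le_bt /andP[]; rewrite leqNgt thP // -leqNgt => le_b.
  rewrite inE eqn_leq le_b andbT.
  move: le_bt; rewrite leq_eqVlt => /predU1P[-> _|lt_bt]; first exact: geq_minl.
  by rewrite thP.
- rewrite /th ltnn /M; have := ltn_ord d.
  have : (abp_layer (abp_start A) <= \max_(u : abp_node A) abp_layer u)%N.
    exact: leq_bigmax.
  by lia.
Qed.

(** * The Raz-Yehudayoff polynomial *)

(** The hypotheses are confined to subscripts between [lo] and [hi] because the variables take
    default values outside [1, ..., N], where a substitution need not respect them. *)
Lemma RYint_morph (S S' : comNzRingType) (f : {rmorphism S -> S'})
    (x : nat -> S) (w : nat -> nat -> nat -> S)
    (x' : nat -> S') (w' : nat -> nat -> nat -> S') (lo hi : nat) :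
  (forall k, (lo <= k <= hi)%N -> f (x k) = x' k) ->
  (forall i k j, (lo <= i)%N -> (i <= k <= j)%N -> (j <= hi)%N ->
     f (w i k j) = w' i k j) ->
  forall i j, (lo <= i)%N -> (j <= hi)%N -> f (RYint x w i j) = RYint x' w' i j.
Proof.
move=> fx fw i j; rewrite /RYint; move: (ilen i j) => n.
elim: n i j => [|n IHn] i j lo_i j_hi /=; first by rewrite rmorph1.
rewrite /ilen; case: eqP => [_|len]; first by rewrite rmorph1.
rewrite rmorphD rmorphM rmorphD rmorph1 rmorphM /= !fx; try lia.
congr (_ * _ + _); first by apply: IHn; lia.
rewrite rmorph_sum /= [LHS]big_nat_cond [RHS]big_nat_cond.
apply: eq_bigr => k.
case/andP=> /andP[lt_ik lt_kj] _.
by rewrite !rmorphM /= fw ?IHn //; lia.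
Qed.

(** * Coefficients at a degree bound *)

Section TopCoefficient.
Variable F : comNzRingType.
Implicit Types p q : {poly F}.

Lemma size_mul_top p q a b : (size p <= a.+1)%N -> (size q <= b.+1)%N ->
  (size (p * q)%R <= (a + b).+1)%N.
Proof.
move=> sp sq; apply: leq_trans (size_polyMleq _ _) _.
by rewrite -subn1 leq_subLR; apply: leq_trans (leq_add sp sq) _; lia.
Qed.

(** Here [a] and [b] only bound the degrees, so these coefficients may vanish. Every other term of
    the convolution exceeds one of the bounds. *)
Lemma coef_mul_top p q a b : (size p <= a.+1)%N -> (size q <= b.+1)%N ->
  (p * q)`_(a + b) = p`_a * q`_b.
Proof.
move=> sp sq; have lt_a : (a < (a + b).+1)%N by lia.
rewrite coefM (bigD1 (Ordinal lt_a)) //= addKn big1 ?addr0 // => i.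
rewrite -val_eqE /= => ne_ia.
have [lt_ia|le_ai] := ltnP i a.
  by rewrite [q`__]nth_default ?mulr0 //; apply: leq_trans sq _; lia.
by rewrite nth_default ?mul0r //; apply: leq_trans sp _; lia.
Qed.

Lemma coef_prod_top (I : Type) (s : seq I) (P : I -> {poly F}) d :
  (forall i, (size (P i) <= d.+1)%N) ->
  (size (\prod_(i <- s) P i)%R <= (size s * d).+1)%N
  /\ (\prod_(i <- s) P i)`_(size s * d) = \prod_(i <- s) (P i)`_d.
Proof.
move=> sP; elim: s => [|i s [IHs IHc]].
  by rewrite !big_nil /= size_poly1 coef1.
rewrite !big_cons /= mulSn; split; first exact: size_mul_top.
by rewrite coef_mul_top // IHc.
Qed.

(** Each term of the Leibniz expansion is a product of [n] entries of degree at most [d]. *)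
Lemma coef_det_top n d (M : 'M[{poly F}]_n) :
  (forall i j, (size (M i j) <= d.+1)%N) ->
  (\det M)`_(n * d) = \det (\matrix_(i, j) (M i j)`_d).
Proof.
move=> sM; rewrite /determinant coef_sum; apply: eq_bigr => s _.
have [_] := coef_prod_top (index_enum 'I_n) (fun i => sM i (s i)).
have -> : size (index_enum 'I_n) = n by rewrite -sum1_size sum1_card card_ord.
rewrite !mulr_sign (eq_bigr (fun i => (M i (s i))`_d)) // => e.
have e' : \prod_i (M i (s i))`_d = \prod_i (\matrix_(i, j) (M i j)`_d) i (s i).
  by apply: eq_bigr => i _; rewrite mxE.
by case: (odd_perm s); rewrite ?coefN e e'.
Qed.

End TopCoefficient.

(** * A perfect matching between the colour classes in a leading coefficient *)

Section Matching.
Variables (F : fieldType) (c : nat -> bool).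

Definition bal (i l : nat) : bool := (count c (iota i l)).*2 == l.

Lemma bal_split i l l' : bal i l -> bal i l' -> (l' <= l)%N ->
  bal (i + l') (l - l').
Proof.
rewrite /bal => /eqP e /eqP e' le_l; rewrite -(subnKC le_l) iotaD count_cat in e.
by apply/eqP; lia.
Qed.

(* The excess of one colour over the other in a prefix moves by one at each
   step, so it cannot change sign without a balanced prefix. *)
Lemma bal_ends i l : bal i l.+2 -> (forall l', (0 < l' < l.+2)%N -> ~~ bal i l') ->
  c i != c (i + l.+1).
Proof.
move=> b_l nb.
have cntS l' : count c (iota i l'.+1) = (count c (iota i l') + c (i + l'))%N.
  by rewrite -addn1 iotaD count_cat /= addn0.
have cnt1 : count c (iota i 1) = c i :> nat by rewrite /= addn0.
have dir l' : (l' <= l)%N ->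
    if c i then (l'.+1 < (count c (iota i l'.+1)).*2)%N
    else ((count c (iota i l'.+1)).*2 < l'.+1)%N.
  elim: l' => [_|l' IHl lt_l]; first by rewrite cnt1; case: (c i).
  have /nb : (0 < l'.+2 < l.+2)%N by lia.
  have := IHl (ltnW lt_l); rewrite /bal [count c (iota i l'.+2)]cntS.
  by case: (c i); case: (c _); lia.
have := dir l (leqnn _); move: b_l; rewrite /bal cntS.
by case: (c i); case: (c _); lia.
Qed.

(** The last subscript of the shortest balanced proper prefix. If a nonempty interval has none,
    [find] returns the length of the list and the value is [j], outside the summation range of the
    recursion. *)
Definition cut (i j : nat) : nat :=
  (i + find (bal i) (iota 1 (ilen i j).-1))%N.

(** Only the split at [cut] is kept. Its weight has larger degree than anything coming from the
    interval with both ends removed, so a split dominates whenever it is available. *)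
Definition wtop (i k j : nat) : {poly F} :=
  if k == cut i j then 'X^(2 ^ ilen i j) else 0.

Definition RYtop (xi : nat -> F) (i j : nat) : {poly F} :=
  RYint (fun k => (xi k)%:P) wtop i j.

Lemma RYtop_rec xi i j : ilen i j <> 0%N ->
  RYtop xi i j = (1 + xi i * xi j) *: RYtop xi i.+1 j.-1
    + if (i < cut i j < j.-1)%N && ~~ odd (ilen i (cut i j)) then
        'X^(2 ^ ilen i j) * (RYtop xi i (cut i j) * RYtop xi (cut i j).+1 j)
      else 0.
Proof.
move=> len; rewrite /RYtop RYint_rec // -mul_polyC polyCD polyCM; congr (_ + _).
rewrite big_mkcond /=; set k := cut i j.
have [in_k|out_k] := boolP (k \in index_iota i.+1 j.-1).
  rewrite (bigD1_seq k) ?iota_uniq //= [X in _ + X]big1 ?addr0.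
    by move: in_k; rewrite mem_index_iota => ->; rewrite /wtop eqxx mulrA.
  move=> k' /negPf nk; rewrite /wtop -/k nk !mul0r; exact: if_same.
rewrite big_seq big1 => [|k' in_k'].
  by move: out_k; rewrite mem_index_iota => /negPf ->.
rewrite /wtop -/k; case: (k' =P k) => [ek|_]; last by rewrite !mul0r if_same.
by rewrite ek (negPf out_k) in in_k'.
Qed.

(** In the split term both factors come from shorter intervals, and
    [2 ^ n + 2 * 2 ^ n.-1 = 2 ^ n.+1] for length [n > 0]. *)
Lemma size_RYtop xi i j : (size (RYtop xi i j) <= (2 ^ (ilen i j).+1).+1)%N.
Proof.
have [n] := ubnP (ilen i j); elim: n i j => [//|n IHn] i j lt_n.
have [e|len] := eqVneq (ilen i j) 0%N.
  by rewrite /RYtop RYint_nil // size_poly1.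
rewrite RYtop_rec; last exact/eqP.
apply: leq_trans (size_polyD _ _) _; rewrite geq_max; apply/andP; split.
  apply: leq_trans (size_scale_leq _ _) _.
  apply: leq_trans (IHn _ _ _) _; first by move: len lt_n; rewrite /ilen; lia.
  by rewrite ltnS leq_exp2l // ltnS /ilen; lia.
case: ifP => [/andP[/andP[lt_i lt_j] _]|_]; last by rewrite size_poly0.
set k := cut i j in lt_i lt_j *.
have s1 : (size (RYtop xi i k) <= (2 ^ (ilen i j).-1).+1)%N.
  apply: leq_trans (IHn _ _ _) _; first by move: len lt_n; rewrite /ilen; lia.
  by rewrite ltnS leq_exp2l // /ilen; lia.
have s2 : (size (RYtop xi k.+1 j) <= (2 ^ (ilen i j).-1).+1)%N.
  apply: leq_trans (IHn _ _ _) _; first by move: len lt_n; rewrite /ilen; lia.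
  by rewrite ltnS leq_exp2l // /ilen; lia.
have sX : (size ('X^(2 ^ ilen i j) : {poly F}) <= (2 ^ ilen i j).+1)%N.
  by rewrite size_polyXn.
apply: leq_trans (size_mul_top sX (size_mul_top s1 s2)) _.
rewrite ltnS addnn -mul2n -expnS prednK ?lt0n // addnn -mul2n -expnS //.
Qed.

(** With a balanced proper prefix, the split term dominates and the matchings of the two parts are
    joined. Without one, the sum vanishes, the two ends have different colours by [bal_ends], and
    they are matched with each other. Since [d] and [L] are the same for all [xi], one coefficient
    can be read off a whole matrix. *)
Lemma RYtop_matching i l : (0 < i)%N -> bal i l ->
  exists (d : nat) (L : seq (nat * nat)),
  [/\ perm_eq (unzip1 L ++ unzip2 L) (iota i l),
      all (fun z => c z.1 && ~~ c z.2) L &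
      forall xi, (size (RYtop xi i (i + l).-1) <= d.+1)%N /\
        (RYtop xi i (i + l).-1)`_d = \prod_(z <- L) (1 + xi z.1 * xi z.2)].
Proof.
have [n] := ubnP l; elim: n i l => [//|n IHn] i l lt_ln i_gt0 b_l.
case: l => [|[|l]] in lt_ln b_l *.
- exists 0%N, [::]; split=> // xi.
  rewrite addn0 /RYtop RYint_nil; last by rewrite /ilen; lia.
  by rewrite size_poly1 coef1 big_nil.
- by move: b_l; rewrite /bal; lia.
have len : ilen i (i + l.+2).-1 = l.+2 by rewrite /ilen; lia.
have len0 : ilen i (i + l.+2).-1 <> 0%N by rewrite len.
have [hs|nhs] := boolP (has (bal i) (iota 1 l.+1)).
  set m := find (bal i) (iota 1 l.+1).
  have lt_m : (m < l.+1)%N by rewrite -[X in (_ < X)%N](size_iota 1) -has_find.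
  have b_m : bal i m.+1.
    by have := nth_find 0%N hs; rewrite nth_iota // add1n.
  have b_m' := bal_split b_l b_m (ltnW lt_m).
  have ecut : cut i (i + l.+2).-1 = (i + m)%N by rewrite /cut len.
  have em : (0 < m)%N && (m < l)%N && ~~ odd m.+1.
    have := b_m; have := b_m'; rewrite /bal => /eqP e1 /eqP e2.
    by move: (count _ _) (count _ _) e1 e2 => *; lia.
  case/andP: em => /andP[m_gt0 lt_ml] ev_m.
  have [|d1 [L1 [p1 a1 t1]]] := IHn i m.+1 _ i_gt0 b_m; first by lia.
  have [||d2 [L2 [p2 a2 t2]]] := IHn (i + m.+1)%N (l.+2 - m.+1)%N _ _ b_m'.
  + by lia.
  + by lia.
  exists (2 ^ l.+2 + (d1 + d2))%N, (L1 ++ L2); split.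
  + have -> : iota i l.+2 = iota i m.+1 ++ iota (i + m.+1) (l.+2 - m.+1).
      by rewrite -iotaD subnKC //; lia.
    rewrite /unzip1 /unzip2 in p1 p2 *; apply/seq.permP => p.
    rewrite !map_cat !count_cat.
    move/seq.permP: p1 => /(_ p); move/seq.permP: p2 => /(_ p).
    by rewrite !count_cat; lia.
  + by rewrite all_cat a1.
  + move=> xi; rewrite RYtop_rec // ecut len.
    have -> : (i < i + m < (i + l.+2).-1.-1)%N && ~~ odd (ilen i (i + m)).
      have -> : ilen i (i + m) = m.+1 by rewrite /ilen; lia.
      by rewrite ev_m andbT; lia.
    have [s1 c1] := t1 xi; have [s2 c2] := t2 xi.
    rewrite addnS /= in s1 c1.
    have ej : (i + m.+1 + (l.+2 - m.+1)).-1 = (i + l.+2).-1 by lia.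
    rewrite ej addnS in s2 c2.
    have sX : (size ('X^(2 ^ l.+2) : {poly F}) <= (2 ^ l.+2).+1)%N.
      by rewrite size_polyXn.
    (* The first summand has degree below [2 ^ l.+2], the exponent of the weight, so it does not
       reach the coefficient in question. *)
    have s0 : (size ((1 + xi i * xi (i + l.+2).-1) *: RYtop xi i.+1 (i + l.+2).-2)
        <= 2 ^ l.+2)%N.
      apply: leq_trans (size_scale_leq _ _) _.
      apply: leq_trans (size_RYtop _ _ _) _.
      have -> : ilen i.+1 (i + l.+2).-2 = l by rewrite /ilen; lia.
      by rewrite ltn_exp2l.
    split.
      apply: leq_trans (size_polyD _ _) _; rewrite geq_max; apply/andP; split.
        by apply: leq_trans s0 _; lia.
      exact: size_mul_top sX (size_mul_top s1 s2).
    rewrite coefD nth_default ?add0r; last by apply: leq_trans s0 _; lia.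
    rewrite coef_mul_top ?size_mul_top // coef_mul_top //.
    by rewrite coefXn eqxx mul1r c1 c2 big_cat.
have nb l' : (0 < l' < l.+2)%N -> ~~ bal i l'.
  by move=> hl; apply: (hasPn nhs); rewrite mem_iota; lia.
have ne := bal_ends b_l nb.
have b_in : bal i.+1 l.
  move: b_l ne; rewrite /bal -[l.+2]addn1 iotaD count_cat /= addn0.
  by case: (c i); case: (c _) => //=; lia.
have [||d [L [p a t]]] := IHn i.+1 l _ _ b_in; [by lia|by []|].
exists d, ((if c i then (i, (i + l.+1)%N) else ((i + l.+1)%N, i)) :: L); split.
- have -> : iota i l.+2 = i :: iota i.+1 l ++ [:: (i + l.+1)%N].
    by rewrite -[l.+2]addn1 iotaD.
  apply/seq.permP => P; move/seq.permP: p => /(_ P).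
  rewrite !(count_cat, map_cons) /= !(count_cat) /=.
  by case: (c i) => /=; lia.
- by rewrite /= a andbT; move: ne; case ci: (c i) => /=; rewrite ?ci; case: (c _).
move=> xi; rewrite RYtop_rec //.
have -> : cut i (i + l.+2).-1 = (i + l.+1)%N.
  by rewrite /cut len (hasNfind nhs) size_iota.
have -> : (i < i + l.+1 < (i + l.+2).-2)%N = false by lia.
rewrite /= addr0; have [st ct] := t xi.
have ej : (i + l.+2).-2 = (i.+1 + l).-1 by lia.
have ej' : (i + l.+2).-1 = (i + l.+1)%N by lia.
rewrite ej ej'; split; first exact: leq_trans (size_scale_leq _ _) st.
rewrite coefZ ct big_cons; congr (_ * _).
by case: (c i) => //=; rewrite mulrC.
Qed.

End Matching.

(* The Kronecker power of [[1, 1], [1, 2]], whose inverse is the Kronecker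
   power of [[2, -1], [-1, 1]]. *)
Lemma det_matching_matrix (F : fieldType) h (I := {ffun 'I_h -> bool}) :
  \det (\matrix_(i < #|I|, j < #|I|) \prod_(p < h)
     (1 + ((enum_val i : I) p)%:R * ((enum_val j : I) p)%:R) : 'M[F]_#|I|) != 0.
Proof.
set M := \matrix_(_, _) _.
pose nu (a b : bool) : F := if a then (if b then 1 else -1) else (if b then -1 else 2).
pose M' : 'M[F]_#|I| := \matrix_(i, j)
  \prod_(p < h) nu ((enum_val i : I) p) ((enum_val j : I) p).
suff /mulmx1_unit[] : M *m M' = 1%:M by rewrite unitmxE unitfE.
apply/matrixP => i j; rewrite !mxE.
pose G p (v : bool) : F :=
  (1 + ((enum_val i : I) p)%:R * v%:R) * nu v ((enum_val j : I) p).
transitivity (\sum_(b : I) \prod_p G p (b p)).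
  rewrite [RHS](reindex (@enum_val I I)) /=; last exact: onW_bij (enum_val_bij I).
  by apply: eq_bigr => k _; rewrite !mxE -big_split.
rewrite -bigA_distr_bigA /=.
transitivity (\prod_(p < h) ((enum_val i : I) p == (enum_val j : I) p)%:R : F).
  apply: eq_bigr => p _; rewrite big_bool /G /nu.
  by case: ((enum_val i : I) p); case: ((enum_val j : I) p) => /=; ring.
have [->|ne] := eqVneq i j; first by rewrite big1 // => p _; rewrite eqxx.
have [p np] : exists p, (enum_val i : I) p != (enum_val j : I) p.
  apply/existsP; apply: contraNT ne; rewrite negb_exists => /forallP e.
  apply/eqP/enum_val_inj/ffunP => p; exact/eqP/negPn.
by rewrite (bigD1 p) //= (negPf np) mul0r.
Qed.

(** * Full rank of the polynomial for every balanced colouring *)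

Section FullRank.
Variables (F : fieldType) (N : nat).

Definition wmon (i k j : nat) : {mpoly F[#|{: 'I_N * 'I_N * 'I_N}|]} :=
  match insub i.-1, insub k.-1, insub j.-1 with
  | Some a, Some b, Some c => 'X_(enum_rank (a : 'I_N, b : 'I_N, c : 'I_N))
  | _, _, _ => 0
  end.

Definition coord (X : {set 'I_N}) (k : nat) : F :=
  if insub k.-1 is Some o then (o \in X)%:R else 0.

(** At a 0/1 point the value lies in the polynomial ring in the [w] variables. Substitution for them
    is possible there, whereas in the fraction field a denominator could vanish. *)
Lemma meval_RYpoly (X : {set 'I_N}) :
  (RYpoly F N).@[point (ratfunW F N) X] =
  tofrac (RYint (fun k => (coord X k)%:MP) wmon 1 N).
Proof.
rewrite /RYpoly.
pose x' k := tofrac (coord X k)%:MP : ratfunW F N.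
pose w' i k j := tofrac (wmon i k j) : ratfunW F N.
transitivity (RYint x' w' 1 N).
  apply: (@RYint_morph _ _ (meval (point (ratfunW F N) X)) _ _ _ _ 1 N) => //.
    move=> k _; rewrite /xvar /x' /coord; case: insubP => [o _ _|_] /=.
      by rewrite mevalXU /point; case: (o \in X); rewrite ?rmorph1 ?rmorph0.
    by rewrite meval0 !rmorph0.
  move=> i k j _ _ _; rewrite /wvar /w' /wmon.
  do 3![case: insubP => [? _ _|_] /=; last by rewrite meval0 rmorph0].
  by rewrite mevalC.
by apply/esym; apply: (@RYint_morph _ _ _ _ _ _ _ 1 N).
Qed.

Lemma RYpoly_full_rank (c : {set 'I_N}) r : #|c|.*2 = N ->
  rank_le (fun a b => (RYpoly F N).@[point (ratfunW F N) (mix c a b)]) r ->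
  (2 ^ N./2 <= r)%N.
Proof.
move=> cN rk.
pose col k := if insub k.-1 is Some o then (o : 'I_N) \in c else false.
have col_ord (o : 'I_N) : col o.+1 = (o \in c).
  by rewrite /col /= valK.
have bN : bal col 1 N.
  rewrite /bal (iotaDl 1 0) count_map -val_enum_ord count_map.
  rewrite (eq_count (a2 := mem c)) => [|o]; last by rewrite /= add1n col_ord.
  by rewrite -sum1_count big_enum_cond sum1_card -[X in _ == X]cN.
have [d [L [perm_L all_L topL]]] := RYtop_matching F (isT : 0 < 1)%N bN.
have sL : size L = N./2.
  have := perm_size perm_L; rewrite size_cat !size_map size_iota addnn => <-.
  by rewrite doubleK.
have uL : uniq (unzip1 L ++ unzip2 L) by rewrite (perm_uniq perm_L) iota_uniq.
have inL k : k \in unzip1 L ++ unzip2 L -> exists o : 'I_N, k = o.+1.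
  rewrite (perm_mem perm_L) mem_iota => /andP[k_gt0 lt_k].
  have lt_kN : (k.-1 < N)%N by lia.
  by exists (Ordinal lt_kN) => /=; rewrite prednK.
rewrite -sL; set h := size L.
pose I := {ffun 'I_h -> bool}.
pose z p := nth (0%N, 0%N) L p.
have in1 (p : 'I_h) : (z p).1 \in unzip1 L by apply: map_f; apply: mem_nth.
have in2 (p : 'I_h) : (z p).2 \in unzip2 L by apply: map_f; apply: mem_nth.
have colz (p : 'I_h) : col (z p).1 /\ ~~ col (z p).2.
  by apply/andP; apply: (allP all_L); apply: mem_nth.
have inj1 (p p' : 'I_h) : ((z p).1 == (z p').1) = (p == p').
  rewrite /z -!(nth_map _ 0%N fst) // nth_uniq ?size_map //.
  by move: uL; rewrite cat_uniq => /andP[].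
have inj2 (p p' : 'I_h) : ((z p).2 == (z p').2) = (p == p').
  rewrite /z -!(nth_map _ 0%N snd) // nth_uniq ?size_map //.
  by move: uL; rewrite cat_uniq => /and3P[].
(* Bit [p] of [al] is the value at one end of the matching edge [p]. Ordinals start at 0 and
   subscripts at 1, hence [o.+1]. *)
pose emb (ys : 'I_h -> nat) (al : I) : {set 'I_N} :=
  [set o : 'I_N | [exists p, (ys p == o.+1) && al p]].
have embE (ys : 'I_h -> nat) (al : I) p (o : 'I_N) :
    (forall p p', (ys p == ys p') = (p == p')) -> ys p = o.+1 ->
    (o \in emb ys al) = al p.
  move=> inj e; rewrite inE -e; apply/existsP/idP => [[p' /andP[]]|ap].
    by rewrite inj => /eqP ->.
  by exists p; rewrite eqxx.
pose X (al be : I) := mix c (emb (fun p => (z p).1) al) (emb (fun p => (z p).2) be).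
have X1 al be (p : 'I_h) : coord (X al be) (z p).1 = (al p)%:R.
  have [|o e] := inL (z p).1; first by rewrite mem_cat in1.
  have := (colz p).1; rewrite e /coord /= valK col_ord => oc.
  by rewrite in_setU in_setI in_setD oc andbT orbF (embE _ al p o inj1 e).
have X2 al be (p : 'I_h) : coord (X al be) (z p).2 = (be p)%:R.
  have [|o e] := inL (z p).2; first by rewrite mem_cat in2 orbT.
  have := (colz p).2; rewrite e /coord /= valK col_ord => oc.
  by rewrite in_setU in_setI in_setD (negPf oc) andbF (embE _ be p o inj2 e).
have -> : (2 ^ h)%N = #|I| by rewrite card_ffun card_bool card_ord.
have := rank_le_comp (emb (fun p => (z p).1)) (emb (fun p => (z p).2)) rk.
apply: rank_le_det.
pose Mw : 'M_#|I| := \matrix_(i, j)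
  RYint (fun k => (coord (X (enum_val i) (enum_val j)) k)%:MP) wmon 1 N.
have -> : \matrix_(i < #|I|, j < #|I|) (RYpoly F N).@[point (ratfunW F N)
    (mix c (emb (fun p => (z p).1) (enum_val i)) (emb (fun p => (z p).2) (enum_val j)))]
  = map_mx (@tofrac _) Mw.
  by apply/matrixP => i j; rewrite !mxE meval_RYpoly.
rewrite det_map_mx tofrac_eq0.
(* The substitution of [wtop] for the [w] variables; if the determinant is nonzero after it, it was
   nonzero before. *)
pose wsp (t : 'I_#|{: 'I_N * 'I_N * 'I_N}|) : {poly F} :=
  let: (a, b, e) := enum_val t in wtop F col a.+1 b.+1 e.+1.
pose phi := mmap (@polyC F) wsp.
apply/negP => /eqP det0.
have : \det (map_mx phi Mw) = 0 by rewrite det_map_mx det0 rmorph0.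
have -> : map_mx phi Mw =
    \matrix_(i, j) RYtop col (coord (X (enum_val i) (enum_val j))) 1 N.
  apply/matrixP => i j; rewrite !mxE.
  apply: (@RYint_morph _ _ phi _ _ _ _ 1 N) => // [k _|i' k j' h1 h2 h3].
    exact: mmapC.
  rewrite /wmon; case: insubP => [a _ ea|]; last by lia.
  case: insubP => [b _ eb|]; last by lia.
  case: insubP => [e _ ee|]; last by lia.
  rewrite [LHS]mmapX mmap1U /wsp enum_rankK.
  have -> : a.+1 = i' by rewrite [nat_of_ord a]ea prednK; lia.
  have -> : b.+1 = k by rewrite [nat_of_ord b]eb prednK; lia.
  by have -> : e.+1 = j' by rewrite [nat_of_ord e]ee prednK; lia.
(* All entries have degree at most [d], so this coefficient is the determinant of the matching
   products, a Kronecker power. *)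
move=> /(congr1 (fun p : {poly F} => p`_(#|I| * d))).
rewrite coef0 coef_det_top; last first.
  by move=> i j; rewrite mxE; have [] := topL (coord (X (enum_val i) (enum_val j))).
move/eqP; apply/negP.
rewrite (_ : \matrix_(i, j) _ = \matrix_(i < #|I|, j < #|I|) \prod_(p < h)
     (1 + ((enum_val i : I) p)%:R * ((enum_val j : I) p)%:R)).
  exact: det_matching_matrix.
apply/matrixP => i j; rewrite !mxE.
have [_] := topL (coord (X (enum_val i) (enum_val j))).
rewrite add1n /= => ->; rewrite (big_nth (0%N, 0%N)) big_mkord.
by apply: eq_bigr => p _; rewrite X1 X2.
Qed.

End FullRank.

(** * The lower bound *)

(** With a single node the only path is the empty one. *)
Lemma roabp_small_cst (K : fieldType) (N : nat) (f : {mpoly K[N]}) (s : nat) :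
  roabp_computes f s -> (s <= 1)%N ->
  exists k : K, forall X : {set 'I_N}, f.@[point K X] = k.
Proof.
case=> A [_ <- <-]; rewrite /abp_size => le1.
exists (\sum_(d < #|abp_node A|) (abp_start A == abp_term A)%:R) => X.
rewrite meval_abp_poly; apply: eq_bigr => d _.
by have -> : nat_of_ord d = 0%N by have := ltn_ord d; lia.
Qed.

Section LowerBound.
Variables (F : fieldType) (N m : nat).
Variables (f : 'I_m -> polyGX F N) (sz : 'I_m -> nat).
Hypotheses (N_gt0 : (0 < N)%N) (evN : ~~ odd N).
Hypothesis fP : forall i, roabp_computes (f i) (sz i).
Hypothesis sumf : RYpoly F N = \sum_(i < m) f i.

Local Notation K := (ratfunW F N).
Local Notation s := (\max_(i < m) sz i)%N.

Lemma RYpoly_sum_rank (c : {set 'I_N}) r : #|c|.*2 = N ->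
  (forall i, rank_le (fun a b => (f i).@[point K (mix c a b)]) r) ->
  (2 ^ N./2 <= m * r)%N.
Proof.
move=> cN rf; apply: (RYpoly_full_rank (F := F) cN); rewrite sumf.
apply: (@rank_le_trans _ _ _ _ (\sum_(i <- index_enum 'I_m) r)).
  by rewrite sum_nat_const card_ord.
apply: rank_le_ext (rank_le_sum _ rf) => a b.
by rewrite raddf_sum.
Qed.

Lemma exists_balanced : exists c : {set 'I_N}, #|c|.*2 = N.
Proof.
have := @card_balanced 'I_N; rewrite card_ord => /(_ evN) le.
have : (0 < N.+1 * #|[set c : {set 'I_N} | #|c| == N./2]|)%N.
  by apply: leq_trans le; rewrite expn_gt0.
rewrite muln_gt0 /= => /card_gt0P[c]; rewrite inE => /eqP e.
by exists c; rewrite e even_halfK.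
Qed.

Lemma summands_gt0 : (0 < m)%N.
Proof.
have [c cN] := exists_balanced; rewrite lt0n; apply: contraL isT => /eqP m0.
have : forall i : 'I_m, rank_le (fun a b => (f i).@[point K (mix c a b)]) 0.
  by move=> i; have := leq_trans (ltn_ord i) (eq_leq m0).
by move=> /(RYpoly_sum_rank cN); rewrite muln0 leqn0 expn_eq0.
Qed.

(** Otherwise all summands are constant on 0/1 points and the rank is at most 1, while it must be at
    least [2 ^ N./2]. The bound [2 <= s] settles the case of bounded [N]. *)
Lemma max_size_gt1 : (1 < s)%N.
Proof.
rewrite ltnNge; apply/negP => s_le1; have [c cN] := exists_balanced.
have cst i : exists k : K, forall X, (f i).@[point K X] = k.
  by apply: roabp_small_cst (fP i) _; apply: leq_trans s_le1; apply: leq_bigmax.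
have [k kP] := fin_all_exists cst.
have : rank_le (fun a b => (RYpoly F N).@[point K (mix c a b)]) 1.
  apply: rank_le_ext (rank_le_cst _ _ (\sum_i k i)) => a b.
  by rewrite sumf raddf_sum; apply: eq_bigr => i _; rewrite /= kP.
move/(RYpoly_full_rank cN); rewrite -{2}(expn0 2) leq_exp2l //; lia.
Qed.

Lemma summands_ge q : (294 <= q)%N -> (q ^ 5 <= N < q.+1 ^ 5)%N ->
  (s <= 2 ^ q)%N -> (2 ^ q <= m)%N.
Proof.
move=> q_ge /andP[le_qN lt_Nq] s_le.
pose h := (72 * 100 * q ^ 2)%N; pose t := (6 * q)%N; pose D := (8 * q)%N.
(* The blocks cover [86400 q ^ 3] variables, and 294 is the least [q] with [86400 <= q ^ 2]. *)
have le_tB : (t * h.*2 <= N)%N.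
  apply: leq_trans le_qN; rewrite /t /h -mul2n.
  have -> : (6 * q * (2 * (72 * 100 * q ^ 2)) = 864 * 100 * q ^ 3)%N by ring.
  have -> : (q ^ 5 = q * q * q ^ 3)%N by ring.
  by rewrite leq_mul2r; have := leq_mul q_ge q_ge; lia.
have h_gt0 : (0 < h.*2)%N by rewrite /h double_gt0 muln_gt0 expn_gt0; lia.
(* An equality up to the successor: [64 * 225 = 14400]. *)
have hD : (D ^ 2 * 15 ^ 2 <= h.*2.+1)%N.
  rewrite /D /h -mul2n; apply: leqW; apply: eq_leq; ring.
have [blk blkP] := fin_all_exists (fun i => roabp_blocks (fP i) le_tB h_gt0).
pose nb i (c : {set 'I_N}) := (\sum_(b < t) near_balanced D (fiber (blk i) b) c)%N.
pose Bad i := [set c : {set 'I_N} | (3 * q <= nb i c)%N].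
pose Bal := [set c : {set 'I_N} | #|c| == N./2].
have card_Bad i : (2 ^ (6 * q) * #|Bad i| <= 2 ^ N)%N.
  have [blk_le card_blk _] := blkP i.
  have := card_many_near_balanced (3 * q) blk_le card_blk hD.
  have -> : (16 ^ (3 * q) = 2 ^ (6 * q) * 2 ^ (6 * q))%N.
    by rewrite -expnD addnn -mul2n !mulnA (expnM 2 12) (expnM 16 3).
  by rewrite card_ord expnD -mulnA [X in (_ <= X)%N]mulnC leq_pmul2l ?expn_gt0.
have [/existsP[c /andP[balc /forallP goodc]]|] :=
    boolP [exists c, (c \in Bal) && [forall i, c \notin Bad i]].
  have cN : #|c|.*2 = N.
    by move: balc; rewrite inE => /eqP ->; rewrite even_halfK.
  have imb i : (24 * q ^ 2 + (\sum_(b < t.+1)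
      minn #|fiber (blk i) b :&: c| #|fiber (blk i) b :\: c|).*2 <= N)%N.
    have [blk_le _ _] := blkP i.
    have := @sum_min_imbalance _ (blk i) t.+1 c (fun x => blk_le x).
    rewrite card_ord; set smin := (\sum_(b < t.+1) minn _ _)%N.
    rewrite big_ord_recr /= => eN.
    (* A block that is not nearly balanced has imbalance at least [D]. More than [3q] of the [6q]
       blocks are of this kind, for a total of at least [24 q ^ 2]. *)
    have : (\sum_(b < t) D <= \sum_(b < t)
        (imbalance c (fiber (blk i) b) + D * near_balanced D (fiber (blk i) b) c))%N.
      apply: leq_sum => b _; rewrite /near_balanced.
      case: (ltnP _ D) => [_|le_D]; first by rewrite muln1 leq_addl.
      by rewrite muln0 addn0.
    rewrite sum_nat_const card_ord big_split /= -big_distrr /=.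
    have := goodc i; rewrite inE -ltnNge /nb.
    move: (\sum_(b < t) near_balanced _ _ _)%N (\sum_(b < t) imbalance _ _)%N eN.
    move=> x y eN lt_x; rewrite /t /D => le.
    have : (8 * q * x <= 8 * q * (3 * q))%N by rewrite leq_mul2l (ltnW lt_x) orbT.
    have -> : (q ^ 2 = q * q)%N by ring.
    by lia.
  have le_a (i : 'I_m) : (12 * q ^ 2 <= N./2)%N by have := imb i; lia.
  have i0 : 'I_m := Ordinal summands_gt0.
  have rf i : rank_le (fun a b => (f i).@[point K (mix c a b)])
      (2 ^ (q * t.+2 + (N./2 - 12 * q ^ 2))).
    have [_ _ /(_ c)] := blkP i; apply: rank_le_trans.
    rewrite -expn_sum expnD; apply: leq_mul.
      rewrite expnM leq_exp2r //; apply: leq_trans s_le; exact: leq_bigmax.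
    rewrite leq_exp2l //; have := imb i.
    by move: (\sum_(b < t.+1) _)%N (q ^ 2)%N => x y; lia.
  have := RYpoly_sum_rank cN rf; rewrite -{1}(subnKC (le_a i0)).
  (* The size factor [s ^ t.+2] costs [6 q ^ 2 + 2 q] in the exponent against a gain of [12 q ^ 2],
     which leaves room for [q]. *)
  have : (q + q * t.+2 <= 12 * q ^ 2)%N.
    have -> : (q * t.+2 = 6 * q ^ 2 + 2 * q)%N by rewrite /t; ring.
    have : (q * 294 <= q ^ 2)%N by rewrite -mulnn leq_mul2l q_ge orbT.
    by move: (q ^ 2)%N => z; lia.
  move: (12 * q ^ 2)%N (q * t.+2)%N => x y le_x.
  rewrite [(2 ^ (x + _))%N]expnD [(2 ^ (y + _))%N]expnD mulnA.
  rewrite leq_pmul2r ?expn_gt0 // => le.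
  rewrite -(@leq_pmul2r (2 ^ y)) ?expn_gt0 // -expnD.
  by apply: leq_trans le; rewrite leq_exp2l.
rewrite negb_exists => /forallP all_bad.
have : (#|Bal| <= \sum_i #|Bad i|)%N.
  apply: leq_trans (_ : #|\bigcup_i Bad i| <= _)%N; last first.
    apply: (big_ind2 (fun (A : {set {set 'I_N}}) x => (#|A| <= x)%N)) => //.
      by rewrite cards0.
    by move=> A x B y Ax By; apply: leq_trans (leq_card_setU _ _) (leq_add Ax By).
  apply: subset_leq_card; apply/subsetP => c balc.
  have := all_bad c; rewrite balc negb_forall => /existsP[i]; rewrite negbK => ci.
  by apply/bigcupP; exists i.
move=> leBal.
have leBad : (2 ^ (6 * q) * \sum_i #|Bad i| <= m * 2 ^ N)%N.
  rewrite big_distrr /= -[X in (_ <= X * _)%N]card_ord -sum_nat_const.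
  exact: leq_sum.
have := @card_balanced 'I_N; rewrite card_ord => /(_ evN); rewrite -/Bal => leN.
have {leBal leBad leN} : (2 ^ (6 * q) * 2 ^ N <= N.+1 * m * 2 ^ N)%N.
  apply: leq_trans (leq_mul (leqnn _) leN) _.
  rewrite mulnCA -mulnA leq_mul2l /=; apply: leq_trans leBad.
  by rewrite leq_mul2l leBal orbT.
rewrite leq_pmul2r ?expn_gt0 // => le.
have leN : (N.+1 <= 2 ^ (5 * q))%N.
  apply: leq_trans lt_Nq _; rewrite mulnC expnM leq_exp2r //.
  exact: ltn_expl.
have := leq_trans le (leq_mul leN (leqnn m)).
have -> : (6 * q = 5 * q + q)%N by lia.
by rewrite expnD leq_pmul2l ?expn_gt0.
Qed.

End LowerBound.

Lemma fifth_root_nat (N : nat) : exists q, (q ^ 5 <= N < q.+1 ^ 5)%N.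
Proof.
have ex : exists q, (q ^ 5 <= N)%N by exists 0%N.
have ub q : (q ^ 5 <= N -> q <= N)%N.
  by apply: leq_trans; case: q => // q; rewrite expnS leq_pmulr ?expn_gt0.
case: (ex_maxnP ex ub) => q le_q max_q; exists q; rewrite le_q /= ltnNge.
by apply/negP => /max_q; rewrite ltnn.
Qed.

Lemma powR_fifth_root_le (R : realType) (N k : nat) :
  (N <= k ^ 5)%N -> N%:R `^ (1 / 5) <= k%:R :> R.
Proof.
move=> le_Nk.
have -> : k%:R = (k ^ 5)%:R `^ (1 / 5) :> R.
  rewrite natrX -powR_mulrn ?ler0n // -powRrM.
  by rewrite (_ : 5%:R * (1 / 5) = 1) ?powRr1 ?ler0n //; field.
by apply: ge0_ler_powR; rewrite ?nnegrE ?ler0n ?ler_nat // divr_ge0.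
Qed.

Theorem theorem1 (R : realType) :
  exists c c' : R, [/\ 0 < c, 0 < c' &
    forall (F : fieldType) (N m : nat) (f : 'I_m -> polyGX F N)
           (sz : 'I_m -> nat),
      (0 < N)%N -> ~~ odd N ->
      (forall i : 'I_m, roabp_computes (f i) (sz i)) ->
      RYpoly F N = \sum_(i < m) f i ->
      let s := (\max_(i < m) sz i)%N in
      2 `^ (c' * N%:R `^ (1 / 5)) / s%:R `^ (c * (ln N%:R / ln 2))
        <= m%:R].
Proof.
(* The constant 300 exceeds [q.+1] for every [q < 294], so there the numerator is at most 2. *)
exists 1, (1 / 300); split=> [||F N m f sz N_gt0 evN fP sumf]; [lra|lra|].
set s := (\max_(i < m) sz i)%N; cbv zeta.
have m_gt0 := summands_gt0 evN sumf.
have s_gt1 : (1 < s)%N := max_size_gt1 N_gt0 evN fP sumf.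
have [q q_root] := fifth_root_nat N; have /andP[_ lt_Nq] := q_root.
have N_ge2 : (2 <= N)%N by lia.
set num := 2 `^ _; set den := s%:R `^ _.
(* The exponent is the base-2 logarithm of [N], which is at least 1 since [2 <= N]. *)
have den_ge : s%:R <= den.
  rewrite -[X in X <= _]powRr1 ?ler0n // /den.
  apply: ler_powR; first by rewrite ler1n ltnW.
  have ln2_gt0 : 0 < ln 2 :> R by rewrite ln_gt0 // ltr1n.
  by rewrite mul1r ler_pdivlMr // mul1r ler_ln ?posrE ?ltr0n // ler_nat.
have den_gt0 : 0 < den by apply: lt_le_trans den_ge; rewrite ltr0n ltnW.
have num_le k : (q.+1 <= 300 * k)%N -> num <= (2 ^ k)%:R.
  move=> le_k; rewrite natrX -powR_mulrn ?ler0n // /num.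
  apply: ler_powR; first by rewrite ler1n.
  have := powR_fifth_root_le R (ltnW lt_Nq).
  have : (q.+1)%:R <= (300 * k)%:R :> R by rewrite ler_nat.
  by rewrite natrM; lra.
have m_ge1 : 1 <= m%:R :> R by rewrite ler1n.
rewrite ler_pdivrMr //.
have den_case : num <= den -> num <= m%:R * den.
  by move=> /le_trans; apply; rewrite ler_peMl // ltW.
(* For small [q], and later for [s > 2 ^ q], the denominator alone dominates the numerator and
   [1 <= m] suffices. *)
have [q_lt|q_ge] := ltnP q 294.
  apply/den_case/le_trans/den_ge; apply: le_trans (num_le 1%N _) _; first by lia.
  by rewrite expn1 ler_nat.
have num_q : num <= (2 ^ q)%:R by apply: num_le; lia.
have [s_le|s_gt] := leqP s (2 ^ q).
  have le_m := summands_ge N_gt0 evN fP sumf q_ge q_root s_le.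
  apply: le_trans num_q _; apply: le_trans (_ : m%:R <= _); first by rewrite ler_nat.
  by rewrite ler_peMr ?ler0n //; apply: le_trans den_ge; rewrite ler1n ltnW.
apply/den_case/le_trans/den_ge; apply: le_trans num_q _.
by rewrite ler_nat ltnW.
Qed.
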